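(* Fix an integer $k\ge2$. For all $j\ge0$ and $1\le i\le k$ there exists $\gamma(q)\in\mathbb C[[q]]$ with $G_{(k-1)j+i}=1+q^{2j+1}\gamma(q)$.
   Context: Notation: $(a;q)_\infty=\prod_{m\ge0}(1-aq^m)$, $(a_1,\dots,a_r;q)_\infty=\prod_s(a_s;q)_\infty$. Definition of the series. For $1\le i\le k$, $G_i=\dfrac{(-q;q^2)_\infty(q^{2k-2i+1},q^{2k+2i-3},q^{4k-2};q^{4k-2})_\infty}{(q^2;q^2)_\infty}$. Inductively for $j\ge0$: ghosts $\tilde G_{(k-1)j+i}=\dfrac{G_{(k-1)j+i-1}+q^{2(j+1)}G_{(k-1)j+i+1}}{1+q^{2(j+1)}}$ ($2\le i\le k-1$), $\tilde G_{(k-1)j+k}=\dfrac{G_{(k-1)j+k-1}-q^{2j+1}G_{(k-1)j+k}}{1+q^{2(j+1)}}$; next shelf: $G_{(k-1)(j+1)+1}=G_{(k-1)j+k}$ (same index), $G_{(k-1)(j+1)+2}=\tilde G_{(k-1)j+k}$, and for $3\le i\le k$, $G_{(k-1)(j+1)+i}=\dfrac{G_{(k-1)j+k-i+1}-\tilde G_{(k-1)j+k-i+2}}{q^{2(j+1)(i-1)}}-q^{-1}G_{(k-1)(j+1)+i-1}$. *)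

(* Defs.v *)
From HB Require Import structures.
From mathcomp Require Import all_boot all_order all_algebra.
From mathcomp Require Import boolp classical_sets reals.
From mathcomp Require Import complex zify.

Set Implicit Arguments.
Unset Strict Implicit.
Unset Printing Implicit Defensive.

Import GRing.Theory.
Local Open Scope ring_scope.

(** * The ring C[[q]] of formal power series and its fraction field C((q)) *)

Reserved Notation "{ 'fps' F }" (format "{ 'fps'  F }").

(* A wrapper around [nat -> F], whose canonical ring structure in the library
   is the pointwise one. *)
Record fps (F : Type) : Type := FPS { coefs : nat -> F }.
Notation "{ 'fps' F }" := (fps F) : type_scope.

HB.instance Definition _ (F : choiceType) := [isNew for @coefs F].
HB.instance Definition _ (F : choiceType) := [Choice of {fps F} by <:].

Notation "x %:F" := (@tofrac _ x) : ring_scope.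

Section FpsRing.
Variable F : fieldType.
Implicit Types (a b c : {fps F}) (n N : nat).

Lemma fpsP a b : (forall n, coefs a n = coefs b n) -> a = b.
Proof. by case: a => a; case: b => b /= /funext ->. Qed.

Definition fps_add a b : {fps F} := FPS (fun n => coefs a n + coefs b n).
Definition fps_opp a : {fps F} := FPS (fun n => - coefs a n).
Definition fps_zero : {fps F} := FPS (fun=> 0).
Definition fps_one : {fps F} := FPS (fun n => (n == 0)%:R).
Definition fps_mul a b : {fps F} :=
  FPS (fun n => \sum_(i < n.+1) coefs a i * coefs b (n - i)).

Lemma fps_addA : associative fps_add.
Proof. by move=> a b c; apply: fpsP => n; apply: addrA. Qed.
Lemma fps_addC : commutative fps_add.
Proof. by move=> a b; apply: fpsP => n; apply: addrC. Qed.
Lemma fps_add0 : left_id fps_zero fps_add.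
Proof. by move=> a; apply: fpsP => n; apply: add0r. Qed.
Lemma fps_addN : left_inverse fps_zero fps_opp fps_add.
Proof. by move=> a; apply: fpsP => n; apply: addNr. Qed.

HB.instance Definition _ :=
  GRing.isZmodule.Build {fps F} fps_addA fps_addC fps_add0 fps_addN.

Definition fps_trunc N a : {poly F} := \poly_(i < N) coefs a i.

Lemma coef_fps_trunc N a n : (n < N)%N -> (fps_trunc N a)`_n = coefs a n.
Proof. by move=> ltnN; rewrite coef_poly ltnN. Qed.

Lemma coefs_mul_trunc N a b n : (n < N)%N ->
  coefs (fps_mul a b) n = (fps_trunc N a * fps_trunc N b)`_n.
Proof.
move=> ltnN; rewrite coefM; apply: eq_bigr => i _.
by rewrite !coef_fps_trunc //; apply: leq_ltn_trans ltnN;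
  rewrite ?leq_subr // -ltnS.
Qed.

Lemma fps_mulC : commutative fps_mul.
Proof.
by move=> a b; apply: fpsP => n; rewrite !(coefs_mul_trunc _ _ (ltnSn n)) mulrC.
Qed.

Lemma fps_mulA : associative fps_mul.
Proof.
move=> a b c; apply: fpsP => n.
transitivity (fps_trunc n.+1 a * fps_trunc n.+1 b * fps_trunc n.+1 c)`_n.
  rewrite -mulrA coefM; apply: eq_bigr => i _.
  by rewrite coef_fps_trunc // (@coefs_mul_trunc n.+1) // ltnS leq_subr.
rewrite coefM; apply: eq_bigr => i _.
by rewrite coef_fps_trunc ?ltnS ?leq_subr // (@coefs_mul_trunc n.+1).
Qed.

Lemma fps_mul1 : left_id fps_one fps_mul.
Proof.
move=> a; apply: fpsP => n; rewrite /= big_ord_recl /= subn0 mul1r big1 ?addr0//.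
by move=> i _; rewrite mul0r.
Qed.

Lemma fps_mulDl : left_distributive fps_mul fps_add.
Proof.
move=> a b c; apply: fpsP => n /=; rewrite -big_split.
by apply: eq_bigr => i _; apply: mulrDl.
Qed.

Lemma fps_one_neq0 : fps_one != 0.
Proof.
by apply/eqP => /(congr1 (fun a => coefs a 0)) /eqP; rewrite /= oner_eq0.
Qed.

HB.instance Definition _ := GRing.Zmodule_isComNzRing.Build {fps F}
  fps_mulA fps_mulC fps_mul1 fps_mulDl fps_one_neq0.

Definition fps_unit : {pred {fps F}} := fun a => `[< exists b, b * a = 1 >].
Definition fps_inv a : {fps F} := xget a [set b | b * a = 1].

Lemma fps_mulVx : {in fps_unit, left_inverse 1 fps_inv *%R}.
Proof.
move=> a /asboolP[b ba1]; rewrite /fps_inv.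
by case: xgetP => [c _ //|/(_ b)/(_ ba1)].
Qed.

Lemma fps_unitPl a b : b * a = 1 -> fps_unit a.
Proof. by move=> ba1; apply/asboolP; exists b. Qed.

Lemma fps_inv_out : {in [predC fps_unit], fps_inv =1 id}.
Proof.
move=> a /asboolP a_nonunit; rewrite /fps_inv.
by case: xgetP => // b _ ba1; case: a_nonunit; exists b.
Qed.

HB.instance Definition _ := GRing.ComNzRing_hasMulInverse.Build {fps F}
  fps_mulVx fps_unitPl fps_inv_out.

Lemma fps_neq0_order a : a != 0 ->
  exists2 n, coefs a n != 0 & forall i, (i < n)%N -> coefs a i = 0.
Proof.
move=> a_neq0; have exn : exists n, coefs a n != 0.
  apply: contrapT => Na; case/eqP: a_neq0; apply: fpsP => n.
  by apply/eqP/negPn/negP => an; apply: Na; exists n.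
case: (ex_minnP exn) => n an minn; exists n => // i ltin.
by apply/eqP/negPn/negP => /minn; rewrite leqNgt ltin.
Qed.

Lemma fps_integral (a b : {fps F}) : a * b = 0 -> (a == 0) || (b == 0).
Proof.
move=> ab0; apply/norP => -[/fps_neq0_order[m am lta] /fps_neq0_order[n bn ltb]].
have /eqP := congr1 (fun c => coefs c (m + n)) ab0.
have ltm : (m < (m + n).+1)%N by rewrite ltnS leq_addr.
rewrite /= (bigD1 (Ordinal ltm)) //= big1 => [|i neq_im].
  by rewrite addr0 addKn mulf_eq0 (negPf am) (negPf bn).
case: (ltngtP i m) => [ltim|ltmi|eq_im]; first by rewrite lta ?mul0r.
  by rewrite ltb ?mulr0 // ltn_subLR ?ltn_add2r // -ltnS.
by case/eqP: neq_im; apply: val_inj.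
Qed.

HB.instance Definition _ :=
  GRing.ComUnitRing_isIntegral.Build {fps F} fps_integral.

Definition fpsX : {fps F} := FPS (fun n => (n == 1)%:R).

(* The coefficientwise limit: the n-th coefficient is the value at which the
   n-th coefficients of [u 0], [u 1], ... stabilize; it is set to the junk
   value 0 if they do not. *)
Definition fps_lim (u : nat -> {fps F}) : {fps F} :=
  FPS (fun n => xget 0
    [set c | exists N, forall m, (N <= m)%N -> coefs (u m) n = c]).

Lemma coefs_fps_lim (u : nat -> {fps F}) n (c : F) N :
  (forall m, (N <= m)%N -> coefs (u m) n = c) -> coefs (fps_lim u) n = c.
Proof.
move=> uc; rewrite /=; case: xgetP => [d _ [M ud]|/(_ c)]; last by case; exists N.
by rewrite -(ud _ (leq_maxl M N)) uc // leq_maxr.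
Qed.

Definition fps_infprod (f : nat -> {fps F}) : {fps F} :=
  fps_lim (fun N => \prod_(m < N) f m).

(* (a; q)_oo *)
Definition qpoch (a q : {fps F}) : {fps F} :=
  fps_infprod (fun m => 1 - a * q ^+ m).

End FpsRing.

(** * The series and their ghosts *)

Section Series.
Variable F : fieldType.

(* As F is a field, this is the field F((q)) of formal Laurent series. *)
Local Notation K := {fraction {fps F}}.
Local Notation X := (fpsX F).

Definition q : K := X%:F.

Variable k : nat.

(* [G0 i] is the product formula for G_i, 1 <= i <= k.  The exponents are natural
   numbers: none of the subtractions truncates for these i. *)
Definition G0 (i : nat) : K :=
  (qpoch (- X) (X ^+ 2) *
   (qpoch (X ^+ (2 * k - 2 * i + 1)) (X ^+ (4 * k - 2)) *
    qpoch (X ^+ (2 * k + 2 * i - 3)) (X ^+ (4 * k - 2)) *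
    qpoch (X ^+ (4 * k - 2)) (X ^+ (4 * k - 2))))%:F
  / (qpoch (X ^+ 2) (X ^+ 2))%:F.

(* Shelf j is the family of the G_{(k-1)j+i} for 1 <= i <= k; below, [g i]
   stands for G_{(k-1)j+i}, and [ghost_of j g i] for its ghost, 2 <= i <= k. *)
Definition ghost_of (j : nat) (g : nat -> K) (i : nat) : K :=
  if i == k then (g (k - 1)%N - q ^+ (2 * j + 1) * g k) / (1 + q ^+ (2 * (j + 1)))
  else (g (i - 1)%N + q ^+ (2 * (j + 1)) * g (i + 1)%N) / (1 + q ^+ (2 * (j + 1))).

Fixpoint next_shelf (j : nat) (g : nat -> K) (i : nat) : K :=
  match i with
  | 0 => 0
  | 1 => g k
  | 2 => ghost_of j g k
  | i'.+1 =>
      (g (k - i + 1)%N - ghost_of j g (k - i + 2)) / q ^+ (2 * (j + 1) * (i - 1))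
      - q^-1 * next_shelf j g i'
  end.

Fixpoint shelf (j : nat) : nat -> K :=
  if j is j'.+1 then next_shelf j' (shelf j') else G0.

(* The last position of a shelf is the first of the next one, so that the pair
   (j, i) is not determined by (k-1)j+i; for i = k we read the series off the
   next shelf.  Lemma [G_shelf] shows that the choice is immaterial. *)
Definition G (n : nat) : K :=
  shelf ((n - 1) %/ (k - 1)) ((n - 1) %% (k - 1) + 1).

Definition ghostG (n : nat) : K :=
  let j := ((n - 2) %/ (k - 1))%N in
  ghost_of j (shelf j) ((n - 2) %% (k - 1) + 2).

Hypothesis k_ge2 : (2 <= k)%N.

Lemma G_shelf j i : (1 <= i <= k)%N -> G ((k - 1) * j + i) = shelf j i.
Proof.
move=> i_range; have k1_gt0 : (0 < k - 1)%N by lia.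
have -> : G ((k - 1) * j + i) =
    shelf (j + (i - 1) %/ (k - 1)) ((i - 1) %% (k - 1) + 1).
  have -> : ((k - 1) * j + i = j * (k - 1) + (i - 1) + 1)%N by lia.
  by rewrite /G addnK divnMDl // modnMDl.
have [ltik|leki] := ltnP i k.
  rewrite divn_small ?modn_small; [|lia..].
  by rewrite addn0 subnK; last by lia.
have -> : i = k by lia.
by rewrite divnn k1_gt0 modnn (addn1 j).
Qed.

Lemma ghostG_shelf j i : (2 <= i <= k)%N ->
  ghostG ((k - 1) * j + i) = ghost_of j (shelf j) i.
Proof.
move=> i_range; have k1_gt0 : (0 < k - 1)%N by lia.
have -> : ((k - 1) * j + i = j * (k - 1) + (i - 2) + 2)%N by lia.
rewrite /ghostG addnK divnMDl // modnMDl divn_small ?modn_small; [|lia..].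
by rewrite addn0 subnK; last by lia.
Qed.

(* The defining recurrences, for the series indexed by (k-1)j+i. *)

Lemma G_init i : (1 <= i <= k)%N -> G i = G0 i.
Proof. by move=> /(G_shelf 0); rewrite muln0. Qed.

Lemma ghostG_mid j i : (2 <= i <= k - 1)%N ->
  ghostG ((k - 1) * j + i) =
    (G ((k - 1) * j + i - 1) + q ^+ (2 * (j + 1)) * G ((k - 1) * j + i + 1))
    / (1 + q ^+ (2 * (j + 1))).
Proof.
move=> i_range; rewrite ghostG_shelf; last by lia.
rewrite -addnBA; last by lia.
rewrite -addnA !G_shelf; [|lia..].
by rewrite /ghost_of ifN //; lia.
Qed.

Lemma ghostG_last j :
  ghostG ((k - 1) * j + k) =
    (G ((k - 1) * j + k - 1) - q ^+ (2 * j + 1) * G ((k - 1) * j + k))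
    / (1 + q ^+ (2 * (j + 1))).
Proof.
rewrite ghostG_shelf; last by lia.
rewrite -addnBA; last by lia.
rewrite !G_shelf; [|lia..].
by rewrite /ghost_of eqxx.
Qed.

Lemma G_next2 j : G ((k - 1) * (j + 1) + 2) = ghostG ((k - 1) * j + k).
Proof.
rewrite ghostG_shelf; last by lia.
by rewrite addn1 G_shelf //; lia.
Qed.

Lemma G_next j i : (3 <= i <= k)%N ->
  G ((k - 1) * (j + 1) + i) =
    (G ((k - 1) * j + k - i + 1) - ghostG ((k - 1) * j + k - i + 2))
      / q ^+ (2 * (j + 1) * (i - 1))
    - q^-1 * G ((k - 1) * (j + 1) + i - 1).
Proof.
move=> i_range.
rewrite -!addnBA; [|lia..].
rewrite -!addnA ghostG_shelf; last by lia.
have next j' : shelf (j' + 1) = next_shelf j' (shelf j') by rewrite addn1.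
rewrite !G_shelf ?next; [|lia..].
by case: i i_range => [|[|[|i]]] // _; rewrite [X in next_shelf _ _ X]subn1.
Qed.

End Series.

(* Main.v *)
Require Import Defs.
From mathcomp Require Import all_boot all_order all_algebra.
From mathcomp Require Import reals complex zify ring.

(** The Jacobi triple product writes shelf 0 as a bilateral theta series, and
    the recurrences then act on its n-th term through the base q^(2n) of its
    exponential dependence on the index i.  On shelf j this gives the closed form
<<
      G_((k-1)j+i) = P * sum_(n in Z) c_j(n) q^(2n(i-1)),
      P = (-q; q^2)_oo / (q^2; q^2)_oo,
      c_j(n) = (-1)^n q^((2k-1)n^2 + 2(k-1)nj) *
        prod_(1 <= s <= j) (1 - q^(4(n+s))) / ((1 + q^(2s)) (1 + q^(2n+2s-1))),
>>
    in which the terms -j <= n <= -1 vanish.  The next shelf sends the term n of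
    shelf j to the term -(n+j+1) of shelf j+1.  Pairing n with -n-j-1 turns the
    sum into one over n >= 0 whose negative halves are divisible by q^(2j+1);
    the terms n >= 1 are divisible by q^(2j+1) as well, and the term n = 0 is
    P * prod_(1 <= s <= j) (1 - q^(2s)) / (1 + q^(2s-1)) = 1 + O(q^(2j+1)). *)

Set Implicit Arguments.
Unset Strict Implicit.
Unset Printing Implicit Defensive.

Import GRing.Theory.
Local Open Scope ring_scope.

(** * Congruences modulo powers of q *)

Section Congruence.
Variable F : fieldType.
Implicit Types (a b c d : {fps F}) (L n : nat).
Local Notation X := (fpsX F).

Lemma coefsD a b n : coefs (a + b) n = coefs a n + coefs b n.
Proof. by []. Qed.

Lemma coefs_Xmul a n : coefs (X * a) n = if n is m.+1 then coefs a m else 0.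
Proof.
case: n => [|m]; first by rewrite /= big_ord1 mul0r.
rewrite /= big_ord_recl mul0r add0r big_ord_recl /= mul1r subSS subn0.
by rewrite big1 ?addr0 // => i _; rewrite mul0r.
Qed.

Lemma coefs_Xnmul L a n :
  coefs (X ^+ L * a) n = if (n < L)%N then 0 else coefs a (n - L).
Proof.
elim: L n => [|L IHL] n; first by rewrite expr0 mul1r subn0.
rewrite exprS -mulrA coefs_Xmul; by case: n.
Qed.

(** Congruence modulo the ideal generated by X^L. Infinite products are evaluated only through such
    congruences to finite ones. *)
Definition eqmodX L a b := exists c, a = b + X ^+ L * c.

Lemma eqmodXP L a b :
  eqmodX L a b <-> (forall n, (n < L)%N -> coefs a n = coefs b n).
Proof.
split=> [[c ->] n ltnL|eq_ab]; first by rewrite coefsD coefs_Xnmul ltnL addr0.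
exists (FPS (fun n => coefs a (n + L) - coefs b (n + L))); apply: fpsP => n.
rewrite coefsD coefs_Xnmul; case: ltnP => [/eq_ab ->|leLn]; first by rewrite addr0.
by rewrite /= subnK // addrC subrK.
Qed.

Lemma eqmodX_refl L a : eqmodX L a a.
Proof. by exists 0; rewrite mulr0 addr0. Qed.

Lemma eqmodX_sym L a b : eqmodX L a b -> eqmodX L b a.
Proof. by case=> c ->; exists (- c); rewrite mulrN addrK. Qed.

Lemma eqmodX_trans L b a c : eqmodX L a b -> eqmodX L b c -> eqmodX L a c.
Proof. by case=> u -> [v ->]; exists (v + u); rewrite mulrDr addrA. Qed.

Lemma eqmodXD L a b c d :
  eqmodX L a b -> eqmodX L c d -> eqmodX L (a + c) (b + d).
Proof. by case=> u -> [v ->]; exists (u + v); rewrite mulrDr addrACA. Qed.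

Lemma eqmodXM L a b c d :
  eqmodX L a b -> eqmodX L c d -> eqmodX L (a * c) (b * d).
Proof.
case=> u -> [v ->]; exists (b * v + u * d + u * X ^+ L * v); ring.
Qed.

Lemma eqmodXN L a b : eqmodX L a b -> eqmodX L (- a) (- b).
Proof. by case=> u ->; exists (- u); rewrite opprD mulrN. Qed.

Lemma eqmodXW L L' a b : (L' <= L)%N -> eqmodX L a b -> eqmodX L' a b.
Proof.
move=> le_L; case=> u ->; exists (X ^+ (L - L') * u).
by rewrite mulrA -exprD subnKC.
Qed.

Lemma eqmodX_Xn0 L m a : (L <= m)%N -> eqmodX L (X ^+ m * a) 0.
Proof. by move=> le_Lm; apply: (eqmodXW le_Lm); exists a; rewrite add0r. Qed.

Lemma eqmodX_sum L I (r : seq I) (P : pred I) (f g : I -> {fps F}) :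
  (forall i, P i -> eqmodX L (f i) (g i)) ->
  eqmodX L (\sum_(i <- r | P i) f i) (\sum_(i <- r | P i) g i).
Proof.
move=> fg; elim/big_ind2: _ => // [|a b c d]; first exact: eqmodX_refl.
exact: eqmodXD.
Qed.

Lemma eqmodX_prod L I (r : seq I) (P : pred I) (f g : I -> {fps F}) :
  (forall i, P i -> eqmodX L (f i) (g i)) ->
  eqmodX L (\prod_(i <- r | P i) f i) (\prod_(i <- r | P i) g i).
Proof.
move=> fg; elim/big_ind2: _ => // [|a b c d]; first exact: eqmodX_refl.
exact: eqmodXM.
Qed.

Lemma eqmodX_sum0 L I (r : seq I) (P : pred I) (f : I -> {fps F}) :
  (forall i, P i -> eqmodX L (f i) 0) -> eqmodX L (\sum_(i <- r | P i) f i) 0.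
Proof. by move/eqmodX_sum => /(_ r); rewrite big1_eq. Qed.

Lemma eqmodX_prod1 L I (r : seq I) (P : pred I) (f : I -> {fps F}) :
  (forall i, P i -> eqmodX L (f i) 1) -> eqmodX L (\prod_(i <- r | P i) f i) 1.
Proof. by move/eqmodX_prod => /(_ r); rewrite big1_eq. Qed.

(** The coefficients below L are constant from index N on, so the junk value of [fps_lim] cannot
    occur among them. *)
Lemma eqmodX_lim L N (u : nat -> {fps F}) (a : {fps F}) :
  (forall m, (N <= m)%N -> eqmodX L (u m) a) -> eqmodX L (fps_lim u) a.
Proof.
move=> ua; apply/eqmodXP => n ltnL; apply: (@coefs_fps_lim _ _ _ _ N) => m leNm.
by move: n ltnL; apply/eqmodXP; apply: ua.
Qed.

Lemma eqmodX_all a b : (forall L, eqmodX L a b) -> a = b.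
Proof. by move=> ab; apply: fpsP => n; have /eqmodXP := ab n.+1; apply. Qed.

(* The inverse of 1 - X u is the geometric series. *)
Lemma eqmodX1_unit a : eqmodX 1 a 1 -> a \is a GRing.unit.
Proof.
case=> u ->; rewrite expr1; set x := - (X * u).
have -> : 1 + X * u = 1 - x by rewrite opprK.
pose s N := \sum_(i < N) x ^+ i.
have xX i : x ^+ i = X ^+ i * (- u) ^+ i by rewrite -exprMn mulrN.
have sE N : (1 - x) * s N = 1 - x ^+ N by rewrite -[1 - x]opprB mulNr -subrX1 opprB.
have s_lim L : eqmodX L (fps_lim s) (s L).
  apply: (@eqmodX_lim _ L) => m leLm; rewrite /s -(subnKC leLm) big_split_ord /=.
  rewrite -[X in eqmodX _ _ X]addr0; apply: eqmodXD; first exact: eqmodX_refl.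
  apply: eqmodX_sum0 => i _.
  by rewrite xX; apply: eqmodX_Xn0; apply: leq_addr.
apply/unitrPr; exists (fps_lim s).
apply: eqmodX_all => L.
apply: (@eqmodX_trans _ ((1 - x) * s L)); first by apply: eqmodXM (s_lim L); apply: eqmodX_refl.
rewrite sE -[X in eqmodX _ _ X]subr0; apply: eqmodXD; first exact: eqmodX_refl.
by apply: eqmodXN; rewrite xX; apply: eqmodX_Xn0.
Qed.

(** Each factor of index m >= N is 1 modulo X^(v + p m). Writing the argument as X^v * a displays
    this order while allowing both signs a = 1 and a = -1. *)
Lemma eqmodX_qpoch v p N L a : (0 < p)%N -> (L <= v + p * N)%N ->
  eqmodX L (qpoch (X ^+ v * a) (X ^+ p)) (\prod_(m < N) (1 - X ^+ v * a * (X ^+ p) ^+ m)).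
Proof.
move=> p_gt0 leL; apply: (@eqmodX_lim _ N) => m leNm.
rewrite -(subnKC leNm) big_split_ord /=.
rewrite -[X in eqmodX _ _ X]mulr1; apply: eqmodXM; first exact: eqmodX_refl.
apply: eqmodX_prod1 => i _.
rewrite -[X in eqmodX _ _ X]subr0; apply: eqmodXD; first exact: eqmodX_refl.
apply: eqmodXN; rewrite mulrAC -exprM -exprD; apply: eqmodX_Xn0.
by apply: leq_trans leL _; rewrite leq_add2l leq_mul2l leq_addr orbT.
Qed.

Lemma qpoch_unit v p a : (0 < v)%N -> (0 < p)%N ->
  qpoch (X ^+ v * a) (X ^+ p) \is a GRing.unit.
Proof.
move=> v_gt0 p_gt0; apply: eqmodX1_unit.
by have := @eqmodX_qpoch v p 0 1 a p_gt0; rewrite big_ord0; apply; lia.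
Qed.

End Congruence.

(** * The Jacobi triple product *)

Section QBinomial.
Variable A : comNzRingType.
Implicit Types (Q x u : A) (N n s : nat).

Fixpoint qbin Q N s : A :=
  match N, s with
  | _, 0 => 1
  | 0, _.+1 => 0
  | N'.+1, s'.+1 => qbin Q N' s'.+1 + Q ^+ (N' - s') * qbin Q N' s'
  end.

Definition qfact Q N := \prod_(m < N) (1 - Q ^+ m.+1).

Lemma qbin0 Q N : qbin Q N 0 = 1. Proof. by case: N. Qed.

Lemma qbinS Q N s :
  qbin Q N.+1 s.+1 = qbin Q N s.+1 + Q ^+ (N - s) * qbin Q N s.
Proof. by []. Qed.

Lemma qbin_small Q N s : (N < s)%N -> qbin Q N s = 0.
Proof.
elim: N s => [|N IHN] [|s] // ltNs.
by rewrite qbinS !IHN ?mulr0 ?addr0 // ltnW.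
Qed.

Lemma qfactS Q N : qfact Q N.+1 = qfact Q N * (1 - Q ^+ N.+1).
Proof. by rewrite /qfact big_ord_recr. Qed.

(** Induction along the Pascal rule, using 1 - Q^(N+1) = (1 - Q^(N-s)) + Q^(N-s) (1 - Q^(s+1)). *)
Lemma qbin_qfact Q N s : (s <= N)%N ->
  qbin Q N s * (qfact Q s * qfact Q (N - s)) = qfact Q N.
Proof.
have qf0 : qfact Q 0 = 1 by rewrite /qfact big_ord0.
elim: N s => [|N IHN] [|s] //; rewrite ?qbin0 ?qf0 ?subn0 ?mul1r //.
rewrite ltnS => leN; rewrite qbinS subSS (qfactS _ N).
have IHs := IHN s leN.
(* The case s = N is separate: N - (s + 1) truncates there, and the first Pascal term vanishes. *)
move: leN; rewrite leq_eqVlt => /predU1P[eqsN|ltsN].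
  rewrite eqsN subnn qf0 in IHs *.
  by rewrite qbin_small // expr0 mul1r add0r qfactS mulr1 -{2}IHs mulr1 mulrA.
have IHs1 := IHN s.+1 ltsN.
have eN : (N - s = (N - s.+1).+1)%N by lia.
have eQ : Q ^+ N.+1 = Q ^+ (N - s) * Q ^+ s.+1 by rewrite -exprD; congr (_ ^+ _); lia.
rewrite eQ; transitivity
  (qbin Q N s.+1 * (qfact Q s.+1 * qfact Q (N - s.+1)) * (1 - Q ^+ (N - s))
   + Q ^+ (N - s) * (qbin Q N s * (qfact Q s * qfact Q (N - s))) * (1 - Q ^+ s.+1)).
  rewrite (qfactS _ s) {2 5}eN (qfactS _ (N - s.+1)) -eN; ring.
rewrite IHs IHs1; ring.
Qed.

(** Homogeneous form: the second variable u absorbs what would otherwise be negative powers in the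
    triple product. *)
Lemma qbinomial_theorem Q u x N :
  \prod_(m < N) (u + x * Q ^+ m) =
    \sum_(s < N.+1) Q ^+ 'C(s, 2) * qbin Q N s * x ^+ s * u ^+ (N - s).
Proof.
elim: N => [|N IHN]; first by rewrite big_ord0 big_ord1 !mulr1.
pose e s := Q ^+ 'C(s, 2) * qbin Q N s * x ^+ s * u ^+ (N - s).
rewrite big_ord_recr IHN /= mulrDr !mulr_suml.
rewrite [RHS]big_ord_recl /= !mulr1 subn0 mul1r.
have split_term (s : 'I_N.+1) :
    Q ^+ 'C(bump 0 s, 2) * qbin Q N.+1 (bump 0 s) * x ^+ bump 0 s * u ^+ (N.+1 - bump 0 s)
    = Q ^+ 'C(s.+1, 2) * qbin Q N s.+1 * x ^+ s.+1 * u ^+ (N - s)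
      + e s * (x * Q ^+ N).
  rewrite /bump leq0n add1n qbinS subSS /e exprS binS bin1 exprD.
  have -> : Q ^+ N = Q ^+ s * Q ^+ (N - s) by rewrite -exprD subnKC // -ltnS.
  ring.
under [X in _ = _ + X]eq_bigr => s _ do rewrite split_term.
rewrite big_split /= addrA; congr (_ + _).
rewrite [LHS]big_ord_recl [in RHS]big_ord_recr /= (@qbin_small _ N N.+1) //.
rewrite mulr0 !mul0r addr0 qbin0 !mulr1 subn0 mul1r -exprSr; congr (_ + _).
apply: eq_bigr => s _; rewrite /bump leq0n add1n -mulrA -exprSr.
by congr (_ * _ ^+ _); have := ltn_ord s; lia.
Qed.

End QBinomial.

Lemma sum_arith a c n : (\sum_(m < n) (a + 2 * c * m) = a * n + 2 * c * 'C(n, 2))%N.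
Proof.
elim: n => [|n IHn]; first by rewrite big_ord0 !muln0.
by rewrite big_ord_recr IHn /= binS bin1; lia.
Qed.

Lemma double_bin2 n : (2 * 'C(n, 2) + n = n * n)%N.
Proof. by elim: n => // n; rewrite binS bin1; lia. Qed.

Section JacobiTripleProduct.
Variables (A : idomainType) (a l : nat).
Local Notation M := (a + 2 * l)%N.

(* With M = a + 2 l, these are the exponents M r^2 + 2 l r and
   M (r+1)^2 - 2 l (r+1) of the theta series. *)
Definition theta_exp1 r := (M * r * r + 2 * l * r)%N.
Definition theta_exp2 r := (a * r.+1 + M * r * r.+1)%N.

(* Finite form: the q-binomial theorem with base x^(2M), u = x^(2Mn) and
   -x^a for the variable, read from the middle term outwards. *)
Lemma finite_triple_product (x : A) n : x != 0 ->
  \prod_(m < n) (1 - x ^+ (a + 2 * M * m)) *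
  \prod_(m < n) (1 - x ^+ (M + 2 * l + 2 * M * m)) =
  \sum_(r < n.+1) (-1) ^+ r * x ^+ theta_exp1 r * qbin (x ^+ (2 * M)) (2 * n) (n - r)
  - \sum_(r < n) (-1) ^+ r * x ^+ theta_exp2 r * qbin (x ^+ (2 * M)) (2 * n) (n.+1 + r).
Proof.
(* In the product over m < 2n below, the factors with m >= n release x^(2Mn) each, and those with m
   < n release -x^(a+2Mm) each. Together this is (-1)^n x^K, and what remains is the left-hand
   side. *)
move=> x_neq0; pose K := (a * n + 2 * M * 'C(n, 2) + 2 * M * n * n)%N.
have cK : (-1) ^+ n * x ^+ K != 0 by rewrite mulf_neq0 ?expf_neq0 ?signr_eq0 ?oppr_eq0 ?oner_eq0.
apply: (mulfI cK).
have -> : (-1) ^+ n * x ^+ K * (\prod_(m < n) (1 - x ^+ (a + 2 * M * m)) *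
    \prod_(m < n) (1 - x ^+ (M + 2 * l + 2 * M * m))) =
    \prod_(m < 2 * n) (x ^+ (2 * M * n) + - x ^+ a * (x ^+ (2 * M)) ^+ m).
  have -> : (2 * n = n + n)%N by lia.
  rewrite big_split_ord /=.
  have -> : \prod_(m < n) (x ^+ (2 * M * n) + - x ^+ a * (x ^+ (2 * M)) ^+ (n + m)) =
      x ^+ (2 * M * n * n) * \prod_(m < n) (1 - x ^+ (a + 2 * M * m)).
    have -> : x ^+ (2 * M * n * n) = \prod_(m < n) x ^+ (2 * M * n).
      by rewrite prodr_const card_ord exprM.
    rewrite -big_split; apply: eq_bigr => m _ /=; rewrite mulNr -exprM -exprD mulrBr mulr1 -exprD.
    by congr (_ - _ ^+ _); lia.
  have -> : \prod_(m < n) (x ^+ (2 * M * n) + - x ^+ a * (x ^+ (2 * M)) ^+ m) =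
      (-1) ^+ n * x ^+ (a * n + 2 * M * 'C(n, 2)) *
      \prod_(m < n) (1 - x ^+ (M + 2 * l + 2 * M * m)).
    rewrite [X in _ = _ * X](reindex_inj rev_ord_inj) /= -sum_arith -prodrXr.
    have -> : (-1) ^+ n = \prod_(m < n) (-1) :> A by rewrite prodr_const card_ord.
    rewrite -!big_split; apply: eq_bigr => m _ /=; rewrite !mulNr mul1r -exprM mulrBr mulr1 -!exprD.
    by rewrite opprB; congr (_ ^+ _ - _ ^+ _); have := ltn_ord m; nia.
  by rewrite /K (exprD _ (_ + _)); ring.
rewrite qbinomial_theorem.
(* The terms split at the middle index: s = n - r gives the first sum, s = n + 1 + r the second. *)
have -> : (2 * n).+1 = (n.+1 + n)%N by lia.
rewrite big_split_ord /= mulrBr !mulr_sumr; congr (_ + _).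
  rewrite [LHS](reindex_inj rev_ord_inj); apply: eq_bigr => r _ /=.
  have ltr := ltn_ord r; rewrite !subSS; set s := (n - r)%N.
  have nE : n = (r + s)%N by rewrite /s; lia.
  rewrite -!exprM [(- x ^+ a) ^+ _]exprNn -exprM.
  have -> : (-1) ^+ s = (-1) ^+ n * (-1) ^+ r :> A.
    have -> : (-1) ^+ n = (-1) ^+ (r + s) :> A by congr (_ ^+ _).
    by rewrite exprD mulrAC -exprD addnn -mul2n exprM sqrrN expr1n expr1n mul1r.
  transitivity ((-1) ^+ n * (-1) ^+ r * qbin (x ^+ (2 * M)) (2 * n) s *
     x ^+ (2 * M * 'C(s, 2) + a * s + 2 * M * n * (2 * n - s))).
    by rewrite !exprD; ring.
  have -> : (2 * M * 'C(s, 2) + a * s + 2 * M * n * (2 * n - s) = K + theta_exp1 r)%N.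
    rewrite /K /theta_exp1; have := double_bin2 s; have := double_bin2 n.
    have -> : (2 * n - s = r + n)%N by lia.
    move: 'C(s, 2) 'C(n, 2) (nat_of_ord r) nE => c c' r' ->  e1 e2.
    (* The exponents involve M times the binomials, so the linear solver needs both identities
       already scaled by M. *)
    have := congr1 (muln M) e1; have := congr1 (muln M) e2; lia.
  by rewrite exprD; ring.
rewrite -sumrN; apply: eq_bigr => r _ /=.
have ltr := ltn_ord r; set s := (n.+1 + r)%N; set p := (2 * n - s)%N.
rewrite -!exprM [(- x ^+ a) ^+ _]exprNn -exprM.
have -> : (-1) ^+ s = - ((-1) ^+ n * (-1) ^+ r) :> A by rewrite /s exprD exprS mulN1r mulNr.
transitivity (- ((-1) ^+ n * (-1) ^+ r) * qbin (x ^+ (2 * M)) (2 * n) s *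
   x ^+ (2 * M * 'C(s, 2) + a * s + 2 * M * n * p)).
  by rewrite !exprD; ring.
have -> : (2 * M * 'C(s, 2) + a * s + 2 * M * n * p = K + theta_exp2 r)%N.
  rewrite /K /theta_exp2; have := double_bin2 s; have := double_bin2 n.
  have nE : n = (p + r).+1 by rewrite /p /s; lia.
  have sE : s = ((p + r).+1.+1 + r)%N by rewrite /s; lia.
  move: 'C(s, 2) 'C(n, 2) (nat_of_ord r) sE nE => c c' r' -> -> e1 e2.
  have := congr1 (muln M) e1; have := congr1 (muln M) e2; lia.
by rewrite exprD; ring.
Qed.

End JacobiTripleProduct.

(** * From the finite triple product to infinite products *)

Section InfiniteTripleProduct.
Variable F : fieldType.
Local Notation X := (fpsX F).

Lemma fpsX_neq0 : X != 0.
Proof.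
by apply/eqP => /(congr1 (fun a => coefs a 1)) /eqP; rewrite /= oner_eq0.
Qed.

Lemma eqmodX_mulIr L (u a b : {fps F}) : u \is a GRing.unit ->
  eqmodX L (a * u) (b * u) -> eqmodX L a b.
Proof.
move=> u_unit eq_au; rewrite -[a](mulrK u_unit) -[b](mulrK u_unit).
by apply: eqmodXM => //; apply: eqmodX_refl.
Qed.

Lemma eqmodX_qfact p N L : (0 < p)%N -> (L <= p + p * N)%N ->
  eqmodX L (qpoch (X ^+ p) (X ^+ p)) (qfact (X ^+ p) N).
Proof.
move=> p_gt0 leL; have := eqmodX_qpoch (1 : {fps F}) p_gt0 leL; rewrite mulr1.
congr (eqmodX _ _ _); apply: eq_bigr => m _; by rewrite -exprS.
Qed.

(** By [qbin_qfact] the coefficient is a quotient of three finite products, each congruent to the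
    same infinite one when s and N - s are large. *)
Lemma eqmodX_qbin p N s L : (0 < p)%N -> (s <= N)%N ->
  (L <= p + p * s)%N -> (L <= p + p * (N - s))%N ->
  eqmodX L (qbin (X ^+ p) N s * qpoch (X ^+ p) (X ^+ p)) 1.
Proof.
move=> p_gt0 le_sN leL1 leL2; set E := qpoch _ _.
have E_unit : E \is a GRing.unit by rewrite /E -[X in qpoch X _]mulr1; apply: qpoch_unit.
apply: (eqmodX_mulIr E_unit); rewrite mul1r -mulrA.
have leL3 : (L <= p + p * N)%N by lia.
apply: eqmodX_trans (eqmodX_sym (eqmodX_qfact p_gt0 leL3)).
rewrite -(qbin_qfact _ le_sN); apply: eqmodXM; first exact: eqmodX_refl.
by apply: eqmodXM; apply: eqmodX_qfact.
Qed.

(** The finite form is multiplied by E. For r < L the bound n >= 2L keeps the index of the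
    q-binomial coefficient at distance at least L from both ends, so its product with E is 1; for r
    >= L the theta exponent is at least L and the term vanishes. Congruences for all L replace the
    infinite theta sum. *)
Lemma jacobi_triple_product a l L n : (0 < a)%N -> (2 * L <= n)%N ->
  let M := (a + 2 * l)%N in
  eqmodX L
    (qpoch (X ^+ a) (X ^+ (2 * M)) * qpoch (X ^+ (M + 2 * l)) (X ^+ (2 * M)) *
     qpoch (X ^+ (2 * M)) (X ^+ (2 * M)))
    (\sum_(r < n) (-1) ^+ r * (X ^+ theta_exp1 a l r - X ^+ theta_exp2 a l r)).
Proof.
move=> a_gt0 leLn M; have M_gt0 : (0 < 2 * M)%N by rewrite /M; lia.
have qpochE v N : (L <= v + 2 * M * N)%N -> eqmodX L (qpoch (X ^+ v) (X ^+ (2 * M)))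
    (\prod_(m < N) (1 - X ^+ (v + 2 * M * m))).
  move=> leL; have := eqmodX_qpoch (1 : {fps F}) M_gt0 leL; rewrite mulr1.
  congr (eqmodX _ _ _); apply: eq_bigr => m _; by rewrite -exprM -exprD.
set E := qpoch (X ^+ (2 * M)) _.
have le1 : (L <= a + 2 * M * n)%N by nia.
have le2 : (L <= M + 2 * l + 2 * M * n)%N by nia.
apply: eqmodX_trans; first apply: eqmodXM (eqmodX_refl _ _).
  apply: eqmodXM (qpochE _ _ le1) (qpochE _ _ le2).
rewrite finite_triple_product ?fpsX_neq0 // mulrBl !mulr_suml.
under [X in eqmodX _ _ X]eq_bigr => r _ do rewrite mulrBr.
rewrite sumrB big_ord_recr /=.
have term (c : {fps F}) e s r : (r <= e)%N -> (s <= 2 * n)%N ->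
    (r < L -> L <= s /\ L <= 2 * n - s)%N ->
    eqmodX L (c * X ^+ e * qbin (X ^+ (2 * M)) (2 * n) s * E) (c * X ^+ e).
  move=> le_re le_s big_s; have [ltrL|leLr] := ltnP r L.
    rewrite -mulrA -[X in eqmodX _ _ X]mulr1; apply: eqmodXM; first exact: eqmodX_refl.
    have [leLs leLs'] := big_s ltrL.
    have le_mul s' : (L <= s')%N -> (L <= 2 * M + 2 * M * s')%N.
      by move=> leLs1; apply: leq_trans leLs1 _; rewrite -mulnS (leq_trans (leqnSn _)) ?leq_pmull.
    by apply: eqmodX_qbin => //; apply: le_mul.
  rewrite ![c * X ^+ e]mulrC -!mulrA.
  apply: (@eqmodX_trans _ _ 0); first by apply: eqmodX_Xn0; lia.
  by apply: eqmodX_sym; apply: eqmodX_Xn0; lia.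
apply: eqmodXD; last first.
  apply: eqmodXN; apply: eqmodX_sum => r _; have := ltn_ord r => ltr.
  by apply: (@term _ _ _ r); rewrite /theta_exp2; [nia|lia|lia].
rewrite -[X in eqmodX _ _ X]addr0; apply: eqmodXD.
  apply: eqmodX_sum => r _; have := ltn_ord r => ltr.
  by apply: (@term _ _ _ r); rewrite /theta_exp1; [nia|lia|lia].
(* The term r = n of the first sum has no partner in the second; its exponent is at least L. *)
rewrite mulrAC -!mulrA mulrCA; apply: eqmodX_Xn0; rewrite /theta_exp1; nia.
Qed.

End InfiniteTripleProduct.

(** * q-adic convergence in C((q)) *)

Section Laurent.
Variable F : fieldType.
Local Notation X := (fpsX F).
Local Notation K := {fraction {fps F}}.
Local Notation q := (q F).
Implicit Types (x y g : K) (L m : nat).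

Lemma tofrac_fpsXn m : (X ^+ m)%:F = q ^+ m.
Proof. exact: rmorphXn. Qed.

(** Membership in q^L F[[q]] inside F((q)); [adic 0] singles out the power series. *)
Definition adic L x := exists c : {fps F}, x = q ^+ L * c%:F.

Lemma adic_tofrac (a : {fps F}) : adic 0 a%:F.
Proof. by exists a; rewrite expr0 mul1r. Qed.

Lemma adicW L L' x : (L' <= L)%N -> adic L x -> adic L' x.
Proof.
move=> le_L [c ->]; exists (X ^+ (L - L') * c).
by rewrite tofracM tofrac_fpsXn mulrA -exprD subnKC.
Qed.

Lemma adic_q m : adic m (q ^+ m).
Proof. by exists 1; rewrite tofrac1 mulr1. Qed.

Lemma adic0 L : adic L 0.
Proof. by exists 0; rewrite tofrac0 mulr0. Qed.

Lemma adic1 : adic 0 1.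
Proof. exact: (adic_q 0). Qed.

Lemma adicD L x y : adic L x -> adic L y -> adic L (x + y).
Proof. by move=> [c ->] [d ->]; exists (c + d); rewrite tofracD mulrDr. Qed.

Lemma adicN L x : adic L x -> adic L (- x).
Proof. by move=> [c ->]; exists (- c); rewrite tofracN mulrN. Qed.

Lemma adicB L x y : adic L x -> adic L y -> adic L (x - y).
Proof. by move=> xL /adicN; apply: adicD. Qed.

Lemma adicM L L' x y : adic L x -> adic L' y -> adic (L + L') (x * y).
Proof. by move=> [c ->] [d ->]; exists (c * d); rewrite tofracM exprD mulrACA. Qed.

Lemma adicMl L x y : adic 0 x -> adic L y -> adic L (x * y).
Proof. exact: adicM. Qed.

Lemma adicMr L x y : adic L x -> adic 0 y -> adic L (x * y).
Proof. by move=> xL y0; rewrite mulrC; apply: adicMl. Qed.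

Lemma adic_sum L I (r : seq I) (P : pred I) (f : I -> K) :
  (forall i, P i -> adic L (f i)) -> adic L (\sum_(i <- r | P i) f i).
Proof. by move=> fL; apply: big_ind => //; [apply: adic0|apply: adicD]. Qed.

Lemma adic_prod I (r : seq I) (P : pred I) (f : I -> K) :
  (forall i, P i -> adic 0 (f i)) -> adic 0 (\prod_(i <- r | P i) f i).
Proof. by move=> fL; apply: big_ind => //; [apply: adic1|apply: adicMl]. Qed.

Lemma adic_pow m x : adic 0 x -> adic 0 (x ^+ m).
Proof.
by move=> x0; elim: m => [|m IHm]; [apply: adic1|rewrite exprS; apply: adicMl].
Qed.

Lemma adic_sign m : adic 0 ((-1) ^+ m : K).
Proof. by apply: adic_pow; apply: adicN; apply: adic1. Qed.

Lemma adic_eqmodX L (a b : {fps F}) : eqmodX L a b <-> adic L (a%:F - b%:F).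
Proof.
split=> [[c ->]|[c]].
  by exists c; rewrite tofracD tofracM tofrac_fpsXn addrC addKr.
rewrite -tofrac_fpsXn -tofracM -tofracN -tofracD => /eqP; rewrite tofrac_eq => /eqP ab.
by exists c; rewrite -ab addrC subrK.
Qed.

Lemma q_neq0 : q != 0.
Proof. by rewrite tofrac_eq0 fpsX_neq0. Qed.

Lemma tofrac_unit (u : {fps F}) : u \is a GRing.unit ->
  u%:F != 0 /\ adic 0 (u%:F)^-1.
Proof.
move=> u_unit; have uV : u%:F * (u^-1)%:F = 1 by rewrite -tofracM divrr ?tofrac1.
have u_neq0 : u%:F != 0.
  by apply/eqP => u0; move/eqP: uV; rewrite u0 mul0r eq_sym oner_eq0.
split=> //; have -> : (u%:F)^-1 = (u^-1)%:F by rewrite -[LHS]mulr1 -uV mulKf.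
exact: adic_tofrac.
Qed.

Lemma one_plus_q m : (0 < m)%N -> 1 + q ^+ m != 0 /\ adic 0 (1 + q ^+ m)^-1.
Proof.
move=> m_gt0; have -> : 1 + q ^+ m = (1 + X ^+ m)%:F by rewrite tofracD tofrac1 tofrac_fpsXn.
apply: tofrac_unit; apply: eqmodX1_unit; exists (X ^+ m.-1).
by rewrite -exprD add1n prednK.
Qed.

Lemma one_plus_q_neq0 m : (0 < m)%N -> 1 + q ^+ m != 0.
Proof. by case/one_plus_q. Qed.

Lemma adic_one_plus_qV m : (0 < m)%N -> adic 0 (1 + q ^+ m)^-1.
Proof. by case/one_plus_q. Qed.

Definition qcvg (u : nat -> K) g :=
  forall L, exists N0, forall N, (N0 <= N)%N -> adic L (g - u N).

Lemma qcvgD u g v h : qcvg u g -> qcvg v h -> qcvg (fun N => u N + v N) (g + h).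
Proof.
move=> ug vh L; have [N0 uN] := ug L; have [N1 vN] := vh L.
exists (maxn N0 N1) => N; rewrite geq_max => /andP[/uN uL /vN vL].
by rewrite opprD addrACA; apply: adicD.
Qed.

Lemma qcvgM u g c : adic 0 c -> qcvg u g -> qcvg (fun N => c * u N) (c * g).
Proof.
move=> c0 ug L; have [N0 uN] := ug L; exists N0 => N /uN.
by rewrite -mulrBr; apply: adicMl.
Qed.

Lemma qcvgN u g : qcvg u g -> qcvg (fun N => - u N) (- g).
Proof.
move=> ug L; have [N0 uN] := ug L; exists N0 => N /uN.
by rewrite -opprD; apply: adicN.
Qed.

Lemma qcvgB u g v h : qcvg u g -> qcvg v h -> qcvg (fun N => u N - v N) (g - h).
Proof. by move=> ug /qcvgN; apply: qcvgD. Qed.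

(** Dividing by q^m loses m orders of precision, a fixed amount, so the convergence is used at order
    m + L. *)
Lemma qcvg_divq m u g : qcvg u g -> qcvg (fun N => u N / q ^+ m) (g / q ^+ m).
Proof.
move=> ug L; have [N0 uN] := ug (m + L)%N; exists N0 => N /uN[c].
rewrite -mulrBl => ->; exists c.
by rewrite exprD -mulrA mulrC mulKf // expf_neq0 // q_neq0.
Qed.

Lemma qcvg_ext u v g : u =1 v -> qcvg u g -> qcvg v g.
Proof.
by move=> uv ug L; have [N0 uN] := ug L; exists N0 => N /uN; rewrite uv.
Qed.

(** Absorbs the boundary term left in each partial sum when the terms of a new shelf are
    realigned. *)
Lemma qcvg_perturb u w g :
  qcvg u g -> (forall N, adic N (w N)) -> qcvg (fun N => u N + w N) g.
Proof.
move=> ug wN L; have [N0 uN] := ug L; exists (maxn N0 L) => N.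
rewrite geq_max => /andP[/uN uL leLN].
by rewrite opprD addrA; apply: adicB => //; apply: adicW (wN N).
Qed.

(** * Linearity and q-adic continuity of the shelf recurrences *)

Section Shelf.
Variable k : nat.

Lemma next_shelf_rec j (g : nat -> K) i :
  next_shelf k j g i.+3 =
    (g (k - i.+3 + 1)%N - ghost_of k j g (k - i.+3 + 2)) / q ^+ (2 * (j + 1) * (i.+3 - 1))
    - q^-1 * next_shelf k j g i.+2.
Proof. by []. Qed.

Lemma ghost_of_sum j N (f : nat -> nat -> K) i :
  ghost_of k j (fun i => \sum_(n < N) f n i) i = \sum_(n < N) ghost_of k j (f n) i.
Proof.
rewrite /ghost_of; case: eqP => _.
  by rewrite -mulr_suml sumrB mulr_sumr.
by rewrite -mulr_suml big_split mulr_sumr.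
Qed.

Lemma next_shelf_sum j N (f : nat -> nat -> K) i :
  next_shelf k j (fun i => \sum_(n < N) f n i) i = \sum_(n < N) next_shelf k j (f n) i.
Proof.
elim: i => [|[|[|i]] IHi]; first by rewrite /= big1.
- by [].
- exact: ghost_of_sum.
rewrite next_shelf_rec IHi ghost_of_sum mulr_sumr -!sumrB mulr_suml -sumrB.
exact: eq_bigr.
Qed.

Lemma qcvg_ghost_of j (u : nat -> nat -> K) (g : nat -> K) i :
  (forall i, (1 <= i <= k)%N -> qcvg (fun N => u N i) (g i)) -> (2 <= i <= k)%N ->
  qcvg (fun N => ghost_of k j (u N) i) (ghost_of k j g i).
Proof.
move=> ug i_range; have den : adic 0 (1 + q ^+ (2 * (j + 1)))^-1.
  by apply: adic_one_plus_qV; lia.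
have q0 m : adic 0 (q ^+ m) by apply: adicW (adic_q m).
rewrite /ghost_of; case: eqP => i_k.
  rewrite mulrC; apply: (@qcvg_ext (fun N => _ * _)) => [N|]; first exact: mulrC.
  by apply: qcvgM => //; apply: qcvgB; [apply: ug; lia|apply: qcvgM => //; apply: ug; lia].
rewrite mulrC; apply: (@qcvg_ext (fun N => _ * _)) => [N|]; first exact: mulrC.
by apply: qcvgM => //; apply: qcvgD; [apply: ug; lia|apply: qcvgM => //; apply: ug; lia].
Qed.

Lemma qcvg_next_shelf j (u : nat -> nat -> K) (g : nat -> K) i : (2 <= k)%N ->
  (forall i, (1 <= i <= k)%N -> qcvg (fun N => u N i) (g i)) -> (1 <= i <= k)%N ->
  qcvg (fun N => next_shelf k j (u N) i) (next_shelf k j g i).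
Proof.
move=> k_ge2 ug; elim: i => [|[|[|i]] IHi] // i_range.
- by apply: ug; lia.
- by apply: qcvg_ghost_of => //; lia.
rewrite next_shelf_rec; apply: (@qcvg_ext (fun N => _ - _)) => [N|].
  by rewrite next_shelf_rec.
apply: qcvgB.
  by apply: qcvg_divq; apply: qcvgB; [apply: ug; lia|apply: qcvg_ghost_of => //; lia].
rewrite mulrC; apply: (@qcvg_ext (fun N => _ * q^-1)) => [N|]; first exact: mulrC.
by rewrite -(expr1 q); apply: qcvg_divq; apply: IHi; lia.
Qed.

End Shelf.
End Laurent.

(** * The recurrences on a single term *)

Lemma divf_sqr_sub_add (K : fieldType) (t v : K) : 1 + t != 0 -> 1 + v != 0 ->
  (1 - t ^+ 2) / ((1 + t) * (1 + v)) = (1 - t) / (1 + v).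
Proof. by move=> t1 v1; field; rewrite v1 t1. Qed.

Lemma divf_cross_sub1 (K : fieldType) (a b c d : K) : c != 0 -> b != 0 ->
  a / b * (d / c) - 1 = (a * d - c * b) * (c^-1 * b^-1).
Proof. by move=> c_neq0 b_neq0; field; rewrite b_neq0 c_neq0. Qed.

(** * Rational identities over an abstract field *)

Section ShelfIdentities.
Variables (K : fieldType) (q v y d w : K).
Local Notation t := (q * v).
Hypotheses (q_neq0 : q != 0) (y_neq0 : y != 0) (v_neq0 : v != 0).
Hypotheses (t1_neq0 : 1 + t != 0) (vy1_neq0 : 1 + v * y != 0).
Local Notation coef := ((1 - t ^+ 2 * y ^+ 2) / ((1 + t) * (1 + v * y))).

(** Here v = q^(2j+1), t = q^(2(j+1)), y = q^(2n), d is the coefficient of the term and [coef] is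
    [shelf_ratio]. In this identity (position 1) and the next one (position 2), w = y^(k-2). *)
Lemma shelf_identity1 :
  d * (w * y) - d * (v * (w * y ^+ 2) * (1 + q * y) / (1 + v * y)) =
  d * (w * y) * coef
  + d * (w * y ^+ 2) * t ^+ 2 * (1 - y ^+ 2) / ((t * y) * (1 + t) * (1 + v * y)).
Proof. by field; rewrite ?q_neq0 ?y_neq0 ?v_neq0 ?t1_neq0 ?vy1_neq0. Qed.

Lemma shelf_identity2 :
  (d * w - d * (v * t * (w * y ^+ 3) * (1 + q * y) / (1 + v * y))
   - v * (d * (w * y) - d * (v * (w * y ^+ 2) * (1 + q * y) / (1 + v * y)))) / (1 + t) =
  d * (w * y) * coef * y
  + d * (w * y ^+ 2) * t ^+ 2 * (1 - y ^+ 2) / ((t * y) ^+ 2 * (1 + t) * (1 + v * y)).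
Proof. by field; rewrite ?q_neq0 ?y_neq0 ?v_neq0 ?t1_neq0 ?vy1_neq0. Qed.

(* w = y^(k-i), e = y^(i-3) and s = t^(i-3). *)
Lemma shelf_identity3 (e s : K) : e != 0 -> s != 0 ->
  let g1 := d * w - d * (v * (s * t ^+ 2) * (w * (e ^+ 2 * (y ^+ 2 * y ^+ 2)) * y) * (1 + q * y) / (1 + v * y)) in
  let g2 := d * (w * y ^+ 2) - d * (v * s * (w * e ^+ 2 * y ^+ 3) * (1 + q * y) / (1 + v * y)) in
  let next e' s' := d * (w * e * y ^+ 2) * coef * e'
    + d * (w * e * y ^+ 3) * t ^+ 2 * (1 - y ^+ 2) / (s' * t * (e' * y) * (1 + t) * (1 + v * y)) in
  (g1 - (g1 + t * g2) / (1 + t)) / (s * t ^+ 2) - q^-1 * next (e * y) (s * t) =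
  next (e * y ^+ 2) (s * t ^+ 2).
Proof.
move=> e_neq0 s_neq0 /=; field.
by rewrite ?q_neq0 ?y_neq0 ?v_neq0 ?t1_neq0 ?vy1_neq0 ?e_neq0 ?s_neq0.
Qed.

(** Induction step of [shelf_coef_shift]: passing from j to j + 1 multiplies v and t by q^2. Here d
    and d1 are the coefficients at n and n + 1, u = y^(k-1) and b = (q^2)^(k-1). *)
Lemma shelf_coef_shift_step (d1 p c u b : K) :
  1 + q ^+ 2 * v * y != 0 ->
  d1 * p * (1 + v * y) = - d * c * (1 - t ^+ 2 * y ^+ 2) * (1 + q * y) ->
  d1 * (b * u) * ((1 - t ^+ 2 * (q ^+ 2 * y) ^+ 2) / ((1 + t) * (1 + v * (q ^+ 2 * y))))
    * p * (1 + q ^+ 2 * v * y) =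
  - (d * u * coef) * (c * b) * (1 - (q ^+ 2 * t) ^+ 2 * y ^+ 2) * (1 + q * y).
Proof.
move=> vy2_neq0 shift; have vy2' : 1 + v * (q ^+ 2 * y) != 0.
  by rewrite mulrCA mulrA.
have {}shift : d1 * p = - d * c * (1 - t ^+ 2 * y ^+ 2) * (1 + q * y) / (1 + v * y).
  by rewrite -shift mulfK.
transitivity (d1 * p * (b * u) * (1 - t ^+ 2 * (q ^+ 2 * y) ^+ 2) / (1 + t)).
  by field; rewrite ?t1_neq0 ?vy2'.
by rewrite shift; field; rewrite ?t1_neq0 ?vy1_neq0.
Qed.

(** Serves [shelf_shiftS], with u = y^(k-1), z = y^k, x = y^(k-i), a = (q^2)^(k-i), s0 = t^(k-1), s
    = t^(k-i), s1 = t^i and f = (q^2 y)^i. *)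
Lemma shelf_shift_identity (d1 p u z s s0 s1 a x f : K) :
  1 + q ^+ 2 * v * y != 0 -> s1 != 0 -> f != 0 -> s0 * t = s * s1 ->
  d1 * p * (1 + v * y) = - d * (q * (u * z) * s0) * (1 - t ^+ 2 * y ^+ 2) * (1 + q * y) ->
  d1 * (a * x * f) * t ^+ 2 * p / (s1 * f * (1 + t) * (1 + v * (q ^+ 2 * y))) =
  - (d * u * coef * (q ^+ 2 * v * (a * s) * (z * x) * (1 + q * y) / (1 + q ^+ 2 * v * y))).
Proof.
move=> vy2_neq0 s1_neq0 f_neq0 s0t shift; have vy2' : 1 + v * (q ^+ 2 * y) != 0.
  by rewrite mulrCA mulrA.
have t_neq0 : t != 0 by rewrite mulf_neq0.
have {s0t}s0E : s0 = s * s1 / t by rewrite -s0t mulfK.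
have {}shift : d1 * p =
    - d * (q * (u * z) * s0) * (1 - t ^+ 2 * y ^+ 2) * (1 + q * y) / (1 + v * y).
  by rewrite -shift mulfK.
transitivity (d1 * p * (a * x) * t ^+ 2 / (s1 * (1 + t) * (1 + v * (q ^+ 2 * y)))).
  by field; rewrite ?s1_neq0 ?f_neq0 ?t1_neq0 ?vy2'.
rewrite shift s0E; field.
by rewrite ?vy2_neq0 ?vy2' ?t1_neq0 ?vy1_neq0 ?s1_neq0 ?q_neq0 ?v_neq0.
Qed.

End ShelfIdentities.

(** * Terms of the closed form and their images on the next shelf *)

Section ClosedForm.
Variables (F : fieldType) (k : nat) (P : {fraction {fps F}}).
Local Notation X := (fpsX F).
Local Notation K := {fraction {fps F}}.
Local Notation q := (q F).
Local Notation y n := (q ^+ (2 * n)).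
Local Notation v j := (q ^+ (2 * j + 1)).
Local Notation t j := (q ^+ (2 * (j + 1))).

(** The factor s = j + 1 of the product in c_j(n); thus [shelf_coef] is P * c_j(n) for n >= 0. *)
Definition shelf_ratio j n : K :=
  (1 - t j ^+ 2 * y n ^+ 2) / ((1 + t j) * (1 + v j * y n)).

Definition shelf_coef j n : K :=
  P * (-1) ^+ n * q ^+ ((2 * k - 1) * n * n + 2 * (k - 1) * n * j) *
  \prod_(s < j) shelf_ratio s n.

(* The term n, its partner -n-j-1 up to sign, and (in [shelf_shift]) the term
   -n-j-1 of shelf j+1, which is the image of the term n of shelf j. *)
Definition shelf_pos j i n : K := shelf_coef j n * y n ^+ (i - 1).

Definition shelf_neg j i n : K :=
  shelf_coef j n * (v j * t j ^+ (k - i) * y n ^+ (2 * k - i) * (1 + q * y n)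
                    / (1 + v j * y n)).

Definition shelf_term j n i : K := shelf_pos j i n - shelf_neg j i n.

Definition shelf_shift j i n : K :=
  shelf_coef j n * y n ^+ k * t j ^+ 2 * (1 - y n ^+ 2)
  / ((t j * y n) ^+ i * (1 + t j) * (1 + v j * y n)).

Lemma tE j : t j = q * v j.
Proof. by rewrite -exprS; congr (_ ^+ _); lia. Qed.

Lemma y_neq0 n : y n != 0. Proof. by rewrite expf_neq0 ?q_neq0. Qed.

Lemma v_neq0 j : v j != 0. Proof. by rewrite expf_neq0 ?q_neq0. Qed.

Lemma t_neq0 j : t j != 0. Proof. by rewrite expf_neq0 ?q_neq0. Qed.

Lemma one_plus_t_neq0 j : 1 + t j != 0.
Proof. by apply: one_plus_q_neq0; lia. Qed.

Lemma one_plus_vy_neq0 j n : 1 + v j * y n != 0.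
Proof. by rewrite -exprD; apply: one_plus_q_neq0; lia. Qed.

Lemma shelf_coefS j n :
  shelf_coef j.+1 n = shelf_coef j n * y n ^+ (k - 1) * shelf_ratio j n.
Proof.
rewrite /shelf_coef big_ord_recr /= -exprM.
have -> : ((2 * k - 1) * n * n + 2 * (k - 1) * n * j.+1 =
  (2 * k - 1) * n * n + 2 * (k - 1) * n * j + 2 * n * (k - 1))%N by lia.
by rewrite exprD; ring.
Qed.

(* The image of a pair {n, -n-j-1} of shelf j is the pair {n, -n-j-1} on shelf
   j+1, where the partner of n is however -n-j-2; [shelf_shiftS] realigns. *)
Lemma shelf_term_next j n i : (2 <= k)%N -> (1 <= i <= k)%N ->
  next_shelf k j (shelf_term j n) i = shelf_pos j.+1 i n + shelf_shift j i n.
Proof.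
move=> k_ge2; rewrite /shelf_pos /shelf_shift shelf_coefS /shelf_ratio.
have [q0 y0 v0] := And3 (q_neq0 F) (y_neq0 n) (v_neq0 j).
have t1 := one_plus_t_neq0 j; have vy1 := one_plus_vy_neq0 j n.
set g := shelf_term j n; set d := shelf_coef j n.
have gE i' : g i' = d * y n ^+ (i' - 1) -
  d * (v j * t j ^+ (k - i') * y n ^+ (2 * k - i') * (1 + q * y n) / (1 + v j * y n)) by [].
elim: i => [|[|[|i]] IHi] // i_range.
- rewrite [LHS]gE subnn !expr0 !mulr1 expr1; set w := (k - 2)%N.
  have -> : (k - 1 = w.+1)%N by lia.
  have -> : (2 * k - k = w + 2)%N by lia.
  have -> : y n ^+ k = y n ^+ w * y n ^+ 2 by rewrite -exprD; congr (_ ^+ _); lia.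
  rewrite ![y n ^+ w.+1]exprSr ![y n ^+ (w + 2)]exprD.
  (* All powers become atoms and t is replaced by q * v, which leaves a rational identity in
     independent variables. *)
  move: (y n) (v j) (t j) (tE j) y0 v0 t1 vy1 => y v _ -> y0 v0 t1 vy1.
  clear gE IHi g; move: (y ^+ w) d q q0 t1 => W {}d q q0 t1.
  by rewrite (@shelf_identity1 K q v y d W q0 y0 v0 t1 vy1).
- rewrite /= /ghost_of eqxx !gE; set w := (k - 2)%N.
  have -> : (k - 1 - 1 = w)%N by lia.
  have -> : (k - (k - 1) = 1)%N by lia.
  have -> : (2 * k - (k - 1) = w + 3)%N by lia.
  have -> : (2 * k - k = w + 2)%N by lia.
  have -> : (k - 1 = w.+1)%N by lia.
  have -> : y n ^+ k = y n ^+ w * y n ^+ 2 by rewrite -exprD; congr (_ ^+ _); lia.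
  rewrite subnn !expr0 !mulr1 ![y n ^+ w.+1]exprSr ![y n ^+ (w + _)]exprD expr1.
  move: (y n) (v j) (t j) (tE j) y0 v0 t1 vy1 => y v _ -> y0 v0 t1 vy1.
  clear gE IHi g; move: (y ^+ w) d q q0 t1 => W {}d q q0 t1.
  by rewrite (@shelf_identity2 K q v y d W q0 y0 v0 t1 vy1).
rewrite next_shelf_rec IHi; last by lia.
(* The ghost sits at position k - i - 1, below k, so the generic formula applies. *)
rewrite /ghost_of ifN; last by lia.
have -> : (k - i.+3 + 2 - 1 = k - i.+3 + 1)%N by lia.
rewrite !gE; set w := (k - i.+3)%N.
have -> : (w + 1 - 1 = w)%N by lia.
have -> : (w + 2 + 1 - 1 = w + 2)%N by lia.
have -> : (k - (w + 1) = i + 2)%N by lia.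
have -> : (k - (w + 2 + 1) = i)%N by lia.
have -> : (2 * k - (w + 1) = w + (i + 2) * 2 + 1)%N by lia.
have -> : (2 * k - (w + 2 + 1) = w + i * 2 + 3)%N by lia.
have -> : (i.+3 - 1 = i + 2)%N by lia.
have -> : (i.+2 - 1 = i.+1)%N by lia.
have -> : (k - 1 = w + i + 2)%N by lia.
have -> : y n ^+ k = y n ^+ w * y n ^+ i * y n ^+ 3 by rewrite -!exprD; congr (_ ^+ _); lia.
rewrite [q ^+ (2 * (j + 1) * _)]exprM.
have e0 := expf_neq0 i y0; have s0 := expf_neq0 i (t_neq0 j).
have -> : y n ^+ (w + (i + 2) * 2 + 1) = y n ^+ w * (y n ^+ i * y n ^+ 2) ^+ 2 * y n.
  by rewrite !exprD exprM exprD expr1.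
have -> : y n ^+ (w + i * 2 + 3) = y n ^+ w * (y n ^+ i) ^+ 2 * y n ^+ 3.
  by rewrite !exprD exprM.
have -> : y n ^+ (w + i + 2) = y n ^+ w * y n ^+ i * y n ^+ 2 by rewrite !exprD.
have pow2 (x : K) : x ^+ i.+2 = x ^+ i * x * x by rewrite !exprSr.
have pow3 (x : K) : x ^+ i.+3 = x ^+ i * x ^+ 2 * x by rewrite exprSr pow2 expr2 mulrA.
rewrite !exprMn !pow3 !pow2 ![_ ^+ i.+1]exprSr ![y n ^+ (_ + 2)]exprD ![t j ^+ (_ + 2)]exprD.
move: (y n ^+ w) (y n ^+ i) (t j ^+ i) e0 s0 => W e s.
move: (y n) (v j) (t j) (tE j) y0 v0 t1 vy1 => y v _ -> y0 v0 t1 vy1 e0 s0.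
clear gE IHi g; move: d q q0 t1 => {}d q q0 t1.
by rewrite (@shelf_identity3 K q v y d W q0 y0 v0 t1 vy1 e s e0 s0).
Qed.

Lemma yS n : y n.+1 = q ^+ 2 * y n.
Proof. by rewrite -exprD; congr (_ ^+ _); lia. Qed.

Lemma vS j : v j.+1 = q ^+ 2 * v j.
Proof. by rewrite -exprD; congr (_ ^+ _); lia. Qed.

Lemma tS j : t j.+1 = q ^+ 2 * t j.
Proof. by rewrite -exprD; congr (_ ^+ _); lia. Qed.

Lemma one_plus_vy2_neq0 j n : 1 + q ^+ 2 * v j * y n != 0.
Proof. by rewrite -vS one_plus_vy_neq0. Qed.

(** The quotient of the coefficients at n + 1 and n, with denominators cleared: in the products over
    s everything but the end factors telescopes. *)
Lemma shelf_coef_shift j n : (1 <= k)%N ->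
  shelf_coef j n.+1 * (1 - y n.+1 ^+ 2) * (1 + v j * y n) =
  - shelf_coef j n * (q * y n ^+ (2 * k - 1) * t j ^+ (k - 1))
    * (1 - t j ^+ 2 * y n ^+ 2) * (1 + q * y n).
Proof.
move=> k_gt0; elim: j => [|j IHj].
  rewrite /shelf_coef !big_ord0 yS muln0 !muln1 !expr1 !addn0 exprS.
  have -> : q ^+ ((2 * k - 1) * n.+1 * n.+1) =
      q ^+ ((2 * k - 1) * n * n) * (q * y n ^+ (2 * k - 1) * (q ^+ 2) ^+ (k - 1)).
    by rewrite -!exprM -exprS -!exprD; congr (_ ^+ _); lia.
  rewrite muln0 addn0 !mulr1; move: ((q ^+ 2) ^+ _) (q ^+ (_ * n * n)) (y n ^+ _) => b c e.
  move: (y n) q => z r; ring.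
rewrite !shelf_coefS /shelf_ratio yS vS tS.
have yE : (q ^+ 2 * y n) ^+ (k - 1) = (q ^+ 2) ^+ (k - 1) * y n ^+ (k - 1) by rewrite exprMn.
have cE : q * y n ^+ (2 * k - 1) * (q ^+ 2 * t j) ^+ (k - 1) =
    q * y n ^+ (2 * k - 1) * t j ^+ (k - 1) * (q ^+ 2) ^+ (k - 1).
  by rewrite exprMn mulrCA mulrC.
rewrite yE cE; move: IHj; rewrite yS.
have [q0 y0 v0] := And3 (q_neq0 F) (y_neq0 n) (v_neq0 j).
have t1 := one_plus_t_neq0 j; have vy1 := one_plus_vy_neq0 j n.
have vy2 := one_plus_vy2_neq0 j n.
clear yE cE; move: (q * y n ^+ _ * _) (y n ^+ (k - 1)) ((q ^+ 2) ^+ (k - 1)) => c u b.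
move: (shelf_coef j n) (shelf_coef j n.+1) => d d1.
move: (y n) (v j) (t j) (tE j) y0 v0 t1 vy1 vy2 => y v _ -> y0 v0 t1 vy1 vy2.
move: q q0 t1 vy2 => q q0 t1 vy2 IHj.
by rewrite (@shelf_coef_shift_step K q v y d t1 vy1 d1 _ c u b vy2 IHj).
Qed.

(** The image of n = 0 has index -j-1, one of the vanishing terms of shelf j + 1; the factor 1 - y^2
    carries the zero. *)
Lemma shelf_shift0 j i : shelf_shift j i 0 = 0.
Proof. by rewrite /shelf_shift muln0 expr0 !expr1n subrr mulr0 mul0r. Qed.

(** Both sides are the term of index -n-j-2 of shelf j + 1, reached as the image of n + 1 and as the
    partner of n. *)
Lemma shelf_shiftS j i n : (1 <= i <= k)%N ->
  shelf_shift j i n.+1 = - shelf_neg j.+1 i n.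
Proof.
move=> i_range; have k_gt0 : (1 <= k)%N by lia.
rewrite /shelf_shift /shelf_neg shelf_coefS /shelf_ratio.
have := shelf_coef_shift j n k_gt0.
have [q0 y0 v0] := And3 (q_neq0 F) (y_neq0 n) (v_neq0 j).
have t1 := one_plus_t_neq0 j; have vy1 := one_plus_vy_neq0 j n.
have vy2 := one_plus_vy2_neq0 j n.
rewrite vS tS; set w := (k - i)%N.
have -> : y n ^+ (2 * k - 1) = y n ^+ (k - 1) * y n ^+ k.
  by rewrite -exprD; congr (_ ^+ _); lia.
have -> : y n ^+ (2 * k - i) = y n ^+ k * y n ^+ w.
  by rewrite -exprD; congr (_ ^+ _); lia.
have -> : y n.+1 ^+ k = (q ^+ 2) ^+ w * y n ^+ w * y n.+1 ^+ i.
  by rewrite -exprMn -yS -exprD; congr (_ ^+ _); lia.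
have s0E : t j ^+ (k - 1) * t j = t j ^+ w * t j ^+ i.
  by rewrite -exprSr -exprD; congr (_ ^+ _); lia.
have s1 := expf_neq0 i (t_neq0 j); have f1 := expf_neq0 i (y_neq0 n.+1).
rewrite [(_ * y n.+1) ^+ i]exprMn [(_ * t j) ^+ w]exprMn.
move: (t j ^+ (k - 1)) (t j ^+ w) (t j ^+ i) (y n.+1 ^+ i) s0E s1 f1.
move: (y n ^+ (k - 1)) (y n ^+ k) (y n ^+ w) ((q ^+ 2) ^+ w).
move: (shelf_coef j n) (shelf_coef j n.+1); rewrite yS.
move: (y n) (v j) (t j) (tE j) y0 v0 t1 vy1 vy2 => y v _ -> y0 v0 t1 vy1 vy2.
move: q q0 t1 vy2 => q q0 t1 vy2 d d1 u z x a s0 s s1 f s0E s1_neq0 f_neq0 shift.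
by rewrite (@shelf_shift_identity K q v y d q0 v0 t1 vy1 d1 _ u z s s0 s1 a x f vy2 s1_neq0 f_neq0 s0E shift).
Qed.

End ClosedForm.

(** * The closed form and its leading term *)

Section Convergence.
Variables (F : fieldType) (k : nat).
Hypothesis k_ge2 : (2 <= k)%N.
Local Notation X := (fpsX F).
Local Notation K := {fraction {fps F}}.
Local Notation q := (q F).
Local Notation y n := (q ^+ (2 * n)).
Local Notation v j := (q ^+ (2 * j + 1)).
Local Notation t j := (q ^+ (2 * (j + 1))).

Let E1 := qpoch (- X) (X ^+ 2).
Let E2 := qpoch (X ^+ 2) (X ^+ 2).

Definition prefactor : K := E1%:F / E2%:F.
Local Notation P := prefactor.

(** The first factor left out is 1 + X^(2j+1), whence the modulus. [eqmodX_E2] keeps the same number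
    of factors, the first omitted one being 1 - X^(2j+2). *)
Lemma eqmodX_E1 L j : (L <= 2 * j + 1)%N ->
  eqmodX L E1 (\prod_(s < j) (1 + X ^+ (2 * s + 1))).
Proof.
move=> leL; have := @eqmodX_qpoch F 1 2 j L (-1) isT.
rewrite expr1 mulrN1 addnC => /(_ leL).
congr (eqmodX _ _ _); apply: eq_bigr => s _.
by rewrite mulNr opprK -exprM -exprS addn1.
Qed.

Lemma eqmodX_E2 L j : (L <= 2 * j + 1)%N ->
  eqmodX L E2 (\prod_(s < j) (1 - X ^+ (2 * (s + 1)))).
Proof.
move=> leL; have := @eqmodX_qpoch F 2 2 j L 1 isT.
rewrite mulr1 => /(_ ltac:(lia)).
congr (eqmodX _ _ _); apply: eq_bigr => s _.
by rewrite -exprM -exprD; congr (_ - _ ^+ _); lia.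
Qed.

Lemma E2_unit : E2 \is a GRing.unit.
Proof. by apply: eqmodX1_unit; have := @eqmodX_E2 1 0 isT; rewrite big_ord0. Qed.

Lemma adic_prefactor : adic 0 P.
Proof. by apply: adicMl; [apply: adic_tofrac|case: (tofrac_unit E2_unit)]. Qed.

Lemma adic_qn m : adic 0 (q ^+ m).
Proof. exact: adicW (adic_q _ m). Qed.

Lemma adic_one_plus_vyV j n : adic 0 (1 + v j * y n)^-1.
Proof. by rewrite -exprD; apply: adic_one_plus_qV; lia. Qed.

Lemma adic_shelf_ratio j n : adic 0 (shelf_ratio F j n).
Proof.
apply: adicMl; first by apply: adicB; [apply: adic1|rewrite -!exprM -exprD; apply: adic_qn].
rewrite invfM; apply: adicMl; first by apply: adic_one_plus_qV; lia.
exact: adic_one_plus_vyV.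
Qed.

Lemma adic_shelf_coef j n :
  adic ((2 * k - 1) * n * n + 2 * (k - 1) * n * j) (shelf_coef k P j n).
Proof.
apply: adicMr; last by apply: adic_prod => s _; apply: adic_shelf_ratio.
apply: adicMl (adic_q _ _).
exact: adicMl adic_prefactor (adic_sign _ _).
Qed.

Lemma adic_shelf_neg j i n :
  adic ((2 * k - 1) * n * n + 2 * (k - 1) * n * j + (2 * j + 1)) (shelf_neg k P j i n).
Proof.
apply: adicM (adic_shelf_coef j n) _; apply: adicMr (adic_one_plus_vyV j n).
apply: adicMr; last by rewrite -exprS; apply: adicD; [apply: adic1|apply: adic_qn].
rewrite -mulrA; apply: adicMr (adic_q _ _) _.
by apply: adicMl; rewrite -exprM; apply: adic_qn.
Qed.

(** The denominator (t y)^i obscures the order, which is therefore read off [shelf_neg] through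
    [shelf_shiftS]. *)
Lemma adic_shelf_shift j i n : (1 <= i <= k)%N -> adic n (shelf_shift k P j i n).
Proof.
move=> i_range; case: n => [|n]; first by rewrite shelf_shift0; apply: adic0.
rewrite shelf_shiftS //; apply: adicN; apply: adicW (adic_shelf_neg j.+1 i n); nia.
Qed.

(** The triple product with a = 2k - 2i + 1 and l = i - 1, hence M = 2k - 1: its two theta exponents
    are those of [shelf_pos] and [shelf_neg] on shelf 0. *)
Lemma qcvg_G0 i : (1 <= i <= k)%N ->
  qcvg (fun N => \sum_(n < N) shelf_term k P 0 n i) (G0 F k i).
Proof.
move=> i_range; set a := (2 * k - 2 * i + 1)%N; set l := (i - 1)%N.
have a_gt0 : (0 < a)%N by rewrite /a; lia.
pose th n : {fps F} := (-1) ^+ n * (X ^+ theta_exp1 a l n - X ^+ theta_exp2 a l n).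
have termE n : shelf_term k P 0 n i = P * (th n)%:F.
  rewrite /shelf_term /shelf_pos /shelf_neg /shelf_coef big_ord0 mulr1.
  (* On shelf 0, v equals q, so the factor (1 + q y) / (1 + v y) cancels. *)
  rewrite [(_ * (1 + _ * _)) / _]mulfK; last first.
    by have := one_plus_vy_neq0 F 0 n; rewrite muln0 add0n expr1.
  rewrite -mulrBr /th tofracM [((-1) ^+ n)%:F]tofracXn tofracN tofrac1 tofracD tofracN !tofrac_fpsXn.
  rewrite muln0 addn0 -!mulrA; congr (_ * (_ * _)).
  rewrite mulrBr mulrA -!exprM -!exprD /theta_exp1 /theta_exp2.
  have -> : a = (2 * (k - i) + 1)%N by rewrite /a; lia.
  have -> : (2 * k - 1 = 2 * (k - i) + 2 * l + 1)%N by rewrite /l; lia.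
  have -> : (2 * k - i = 2 * (k - i) + l + 1)%N by rewrite /l; lia.
  rewrite -/l; clearbody l th; move: (k - i)%N => w.
  by congr (_ * (_ ^+ _ - _ ^+ _)); lia.
set Th := qpoch (X ^+ a) (X ^+ (4 * k - 2)) *
    qpoch (X ^+ (2 * k + 2 * i - 3)) (X ^+ (4 * k - 2)) *
    qpoch (X ^+ (4 * k - 2)) (X ^+ (4 * k - 2)).
have G0E : G0 F k i = P * Th%:F by rewrite /G0 tofracM mulrAC.
rewrite G0E; apply: (@qcvg_ext _ (fun N => P * (\sum_(n < N) th n)%:F)) => [N|].
  rewrite raddf_sum mulr_sumr; apply: eq_bigr => n _; by rewrite termE.
apply: qcvgM => [|L]; first exact: adic_prefactor.
exists (2 * L)%N => N leN; apply/adic_eqmodX.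
have := @jacobi_triple_product F a l L N a_gt0 leN; cbv zeta.
have -> : (2 * (a + 2 * l) = 4 * k - 2)%N by rewrite /a /l; lia.
have -> : (a + 2 * l + 2 * l = 2 * k + 2 * i - 3)%N by rewrite /a /l; lia.
by [].
Qed.

(** Reindexing n + 1 as n, the term 0 being zero; the term N is the boundary term. *)
Lemma sum_shelf_shift j i N : (1 <= i <= k)%N ->
  \sum_(n < N) shelf_shift k P j i n + shelf_shift k P j i N =
  - \sum_(n < N) shelf_neg k P j.+1 i n.
Proof.
move=> i_range; elim: N => [|N IHN]; first by rewrite !big_ord0 shelf_shift0 addr0 oppr0.
by rewrite !big_ord_recr /= IHN shelf_shiftS // opprD.
Qed.

(** The closed form, by induction on j: the recurrences act termwise on partial sums and preserve
    limits, and after realignment the partial sums differ only by a boundary term of order N. *)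
Lemma qcvg_shelf j i : (1 <= i <= k)%N ->
  qcvg (fun N => \sum_(n < N) shelf_term k P j n i) (shelf F k j i).
Proof.
elim: j i => [|j IHj] i i_range; first exact: qcvg_G0.
apply: (@qcvg_ext _ (fun N => next_shelf k j (fun i => \sum_(n < N) shelf_term k P j n i) i
                              + shelf_shift k P j i N)) => [N|].
  rewrite next_shelf_sum; under eq_bigr => n _ do rewrite shelf_term_next //.
  by rewrite big_split -addrA sum_shelf_shift // sumrB.
apply: qcvg_perturb; last by move=> N; apply: adic_shelf_shift.
exact: qcvg_next_shelf.
Qed.

(** At n = 0 the product over s is [f2] / [f1], and [f1], [f2] are the truncations of [E1], [E2]; so
    P = [E1] / [E2] cancels it up to the truncation errors. *)
Lemma adic_shelf_coef0 j : adic (2 * j + 1) (shelf_coef k P j 0 - 1).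
Proof.
pose f1 : {fps F} := \prod_(s < j) (1 + X ^+ (2 * s + 1)).
pose f2 : {fps F} := \prod_(s < j) (1 - X ^+ (2 * (s + 1))).
have f1_unit : f1 \is a GRing.unit.
  apply: eqmodX1_unit; apply: eqmodX_prod1 => s _; exists (X ^+ (2 * s)).
  by rewrite -exprD addnC.
have [f1_neq0 f1V] := tofrac_unit f1_unit.
have [E2_neq0 E2V] := tofrac_unit E2_unit.
have -> : shelf_coef k P j 0 = P * (f2%:F / f1%:F).
  rewrite /shelf_coef !muln0 !mul0n expr0 !mulr1; congr (_ * _).
  rewrite !rmorph_prod /= -prodf_div; apply: eq_bigr => s _.
  rewrite /shelf_ratio muln0 expr0 expr1n !mulr1.
  rewrite !tofracD tofracN tofrac1 !tofrac_fpsXn.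
  have t1 := one_plus_t_neq0 F s; have v1 := one_plus_vy_neq0 F s 0.
  rewrite muln0 expr0 mulr1 in v1.
  move: (t s) (v s) t1 v1 => t v t1 v1.
  by rewrite (@divf_sqr_sub_add K t v t1 v1).
(* Cross-multiplication reduces the claim to a congruence between power series. *)
have -> : P * (f2%:F / f1%:F) - 1 = ((E1 * f2)%:F - (f1 * E2)%:F) * ((f1%:F)^-1 * (E2%:F)^-1).
  rewrite /P !tofracM.
  move: (E1%:F) (E2%:F) (f1%:F) (f2%:F) f1_neq0 E2_neq0 => e1 e2 g1 g2 g1_neq0 e2_neq0.
  by rewrite (@divf_cross_sub1 K e1 e2 g1 g2 g1_neq0 e2_neq0).
apply: adicMr; last exact: adicMl.
apply/adic_eqmodX; apply: eqmodXM; first exact: eqmodX_E1.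
by apply: eqmodX_sym; apply: eqmodX_E2.
Qed.

Lemma adic_shelf j i : (1 <= i <= k)%N -> adic (2 * j + 1) (shelf F k j i - 1).
Proof.
move=> i_range; have [N0 cvgN] := qcvg_shelf j i_range (2 * j + 1)%N.
(* A single partial sum is accurate enough; N0 + 1 terms make it nonempty, so that the term n = 0
   can be split off. *)
have {cvgN} := cvgN _ (leqnSn N0); set S := \sum_(n < _) _ => gS.
rewrite -(subrK S (shelf F k j i)) -addrA; apply: adicD => //.
rewrite /S big_ord_recl /shelf_term /shelf_pos muln0 expr0 expr1n mulr1.
rewrite addrAC [_ - _ - 1]addrAC.
have neg n : adic (2 * j + 1) (shelf_neg k P j i n).
  by apply: adicW (adic_shelf_neg j i n); apply: leq_addl.
apply: adicD; first by apply: adicB (neg _); apply: adic_shelf_coef0.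
(* For n >= 1 and k >= 2 the exponent (2k-1)n^2 + 2(k-1)nj is at least 2j + 3. *)
apply: adic_sum => n _ /=; apply: adicB (neg _); apply: adicMr.
  by apply: adicW (adic_shelf_coef j _); rewrite /bump leq0n add1n; nia.
by rewrite -exprM; apply: adic_qn.
Qed.

End Convergence.

(** * From the order of G - 1 to the power series gamma *)

Unset Implicit Arguments.

Theorem mainTheorem4 (R : realType) (k : nat) (k_ge2 : (2 <= k)%N)
    (j i : nat) (i_range : (1 <= i <= k)%N) :
  exists gamma : {fps R[i]},
    G R[i] k ((k - 1) * j + i) =
      (1 + fpsX R[i] ^+ (2 * j + 1) * gamma)%:F.
Proof.
have [gamma gammaE] := adic_shelf R[i] k_ge2 j i_range.
exists gamma; rewrite G_shelf // tofracD tofracM tofrac_fpsXn tofrac1 -gammaE.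
by rewrite addrC subrK.
Qed.
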